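(* Let $H_1\subset U_2$ be the finite group generated by $T=\frac{1+i}{2}\begin{pmatrix}1&1\\1&-1\end{pmatrix}$ and $D=\begin{pmatrix}1&0\\0&i\end{pmatrix}$, let $V_{10}=\mathbb{C}^2$ be its natural representation, and for an integer $k\ge 1$ let $\mathcal{A}_k=\mathrm{End}_{H_1}(V_{10}^{\otimes k})$ be the centralizer algebra of $H_1$ in $V_{10}^{\otimes k}$, where $H_1$ acts diagonally on $V_{10}^{\otimes k}$. Then $\mathcal{A}_k$ has the following multi-matrix structure (isomorphism of $\mathbb{C}$-algebras), where $m\ge 1$ is the integer with $k=2m-1$ or $k=2m$: \[ \mathcal{A}_k\cong \begin{cases} M_{d_+(k)}(\mathbb{C})\oplus M_{d_-(k)}(\mathbb{C})\oplus M_{d_0(k)}(\mathbb{C}) & \text{if } k=2m-1,\\ M_{d_+(k)}(\mathbb{C})\oplus M_{d_-(k)}(\mathbb{C})\oplus M_{d_0(k)}(\mathbb{C})\oplus M_{e_+(k)}(\mathbb{C})\oplus M_{e_-(k)}(\mathbb{C}) & \text{if } k=2m, \end{cases} \] where \[ d_{\pm}(k)=\pm 2^{m-2}+\frac13+\frac{2\cdot 4^{m-2}}{3},\qquad d_0(k)=-\frac13+\frac{4^{m-1}}{3},\qquad e_{\pm}(k)=\pm 2^{m-2}+2\cdot 4^{m-2}. \]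
   Context: $H_1$ is a finite group of order $96$ (the unitary reflection group No. 8 in the Shephard-Todd list). The natural representation is the one in which each matrix of $H_1$ acts on $\mathbb{C}^2$ by matrix multiplication. The diagonal action on $V_{10}^{\otimes k}$ is $g\cdot(v_1\otimes\cdots\otimes v_k)=gv_1\otimes\cdots\otimes gv_k$. $\mathrm{End}_{H_1}(V_{10}^{\otimes k})$ is the algebra of all $\mathbb{C}$-linear endomorphisms of $V_{10}^{\otimes k}$ that commute with the action of every element of $H_1$. $M_d(\mathbb{C})$ denotes the algebra of $d\times d$ complex matrices, with the convention that $M_0(\mathbb{C})$ is the zero algebra (i.e. the summand is absent); some of the sizes are $0$ for small $k$. *)

(* Defs.v *)
From HB Require Import structures.
From mathcomp Require Import all_boot all_order all_algebra.
From mathcomp Require Import boolp reals.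
From mathcomp Require Export complex.

Set Implicit Arguments.
Unset Strict Implicit.
Unset Printing Implicit Defensive.

Import Order.TTheory GRing.Theory Num.Theory.
Local Open Scope ring_scope.

Section Group.
Variable R : realType.

Definition mxT : 'M[R[i]]_2 :=
  ((1 + 'i%C) / 2) *: \matrix_(a < 2, b < 2) (if (a == 1) && (b == 1) then -1 else 1).

Definition mxD : 'M[R[i]]_2 :=
  \matrix_(a < 2, b < 2) (if a == b then (if a == 1 then 'i%C else 1) else 0).

Inductive H1 : 'M[R[i]]_2 -> Prop :=
| H1_one : H1 1%:M
| H1_T : H1 mxT
| H1_D : H1 mxD
| H1_mul g h : H1 g -> H1 h -> H1 (g *m h)
| H1_inv g : H1 g -> H1 (invmx g).

Lemma sqri : ('i%C : R[i]) * 'i%C = -1.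
Proof. by rewrite -expr2 sqr_i. Qed.

Lemma conji : ('i%C : R[i])^* = - 'i%C.
Proof. by apply/eqP; rewrite eq_complex /= oppr0 !eqxx. Qed.

(* Hence every matrix of [H1] is invertible, and [invmx], which is the
   identity on singular matrices, is a true inverse in [H1_inv]. *)
Lemma H1_unitary g : H1 g -> g \is unitarymx.
Proof.
move=> gH; apply/unitarymxP; move: g gH.
have unit_of (h : 'M[R[i]]_2) : h *m map_mx Num.conj h^T = 1%:M -> h \in unitmx.
  by move=> /mulmx1_unit[].
move=> g; elim=> {g} [|||g h _ gU _ hU|g _ gU].
- by rewrite trmx1 map_mx1 mulmx1.
- have cc : ((1 + 'i%C) / 2 : R[i]) * ((1 + 'i%C) / 2)^* = 2^-1.
    rewrite rmorphM /= rmorphD /= fmorphV rmorph_nat rmorph1 conji.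
    rewrite mulrACA mulrDl mul1r mulrBr mulr1 sqri opprK addrA subrK.
    by rewrite mulrA -[1 + 1]/(2%:R) mulfV ?mul1r // pnatr_eq0.
  have cc2 : 2^-1 + 2^-1 = 1 :> R[i].
    by rewrite -mulr2n -[_ *+ 2]mulr_natl mulfV // pnatr_eq0.
  rewrite /mxT; move: (_ / _) cc => c cc; apply/matrixP => a b.
  rewrite !mxE !big_ord_recl big_ord0 !mxE /= !rmorphM /=.
  case: a b => [[|[|//]] ?] [[|[|//]] ?] /=;
    rewrite ?rmorphN1 ?rmorph1 ?mulr1 ?mulrN1 ?mulrN ?mulNr ?opprK addr0 cc.
  - exact: cc2.
  - exact: subrr.
  - exact: subrr.
  - exact: cc2.
- rewrite /mxD; apply/matrixP => a b.
  rewrite !mxE !big_ord_recl big_ord0 !mxE /=.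
  case: a b => [[|[|//]] ?] [[|[|//]] ?] /=;
    rewrite ?conji ?rmorph1 ?rmorph0 ?mulrN ?sqri ?opprK ?mulr0
       ?mul0r ?mulr1 ?addr0 ?add0r ?oppr0 //.
- rewrite trmx_mul map_mxM mulmxA -(mulmxA g) hU mulmx1 gU //.
- have gV := mulmx1C gU.
  have gi : invmx g = map_mx Num.conj g^T.
    by rewrite -[LHS]mulmx1 -gU mulmxA mulVmx ?mul1mx // unit_of.
  rewrite gi map_trmx trmxK -map_mx_comp /=.
  rewrite (_ : map_mx _ g = g) //; apply/matrixP => a b; rewrite mxE /=; exact: conjCK.
Qed.

End Group.

Section TensorPower.
Variables (R : realType) (k : nat).

(* The k-th tensor power of C^2, in coordinates: [t x] is the coefficient of
   e_(x 0) (x) ... (x) e_(x (k-1)) in [t]. The lemmas [diag_act_pure] and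
   [pure_span] below show that [diag_act g] is the linear map with
   v_0 (x) ... (x) v_(k-1) |-> g v_0 (x) ... (x) g v_(k-1). *)
Definition tpow : Type := {ffun {ffun 'I_k -> 'I_2} -> R[i]^o}.

Definition pure (v : 'I_k -> 'cV[R[i]]_2) : tpow :=
  [ffun x : {ffun 'I_k -> 'I_2} => \prod_i v i (x i) 0].

Definition diag_act (g : 'M[R[i]]_2) (t : tpow) : tpow :=
  [ffun x : {ffun 'I_k -> 'I_2} =>
     \sum_(y : {ffun 'I_k -> 'I_2}) (\prod_i g (x i) (y i)) * t y].

Lemma diag_act_linear g : linear (diag_act g).
Proof.
move=> a s t; apply/ffunP => x; rewrite !ffunE scaler_sumr -big_split /=.
by apply: eq_bigr => y _; rewrite !ffunE mulrDr [a *: _ as X in _ * X]/GRing.scale /= mulrCA.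
Qed.

Lemma diag_act_pure g v : diag_act g (pure v) = pure (fun i => g *m v i).
Proof.
have pureE y : pure v y = \prod_i v i (y i) 0 by rewrite ffunE.
apply/ffunP => x; rewrite !ffunE.
under [LHS]eq_bigr => y _ do rewrite pureE -big_split /=.
rewrite -(bigA_distr_bigA (fun i j => g (x i) j * v i j 0)) /=.
by apply: eq_bigr => i _; rewrite mxE.
Qed.

Lemma pure_span (t : tpow) :
  t = \sum_(x : {ffun 'I_k -> 'I_2}) t x *: pure (fun i => delta_mx (x i) 0).
Proof.
have pureE (x y : {ffun 'I_k -> 'I_2}) : pure (fun i => delta_mx (x i) 0) y = (x == y)%:R.
  rewrite ffunE; case: eqP => [->|/eqP neq].
    by rewrite big1 // => i _; rewrite mxE !eqxx.
  have [i ni] : exists i, y i != x i.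
    apply/existsP; apply: contraNT neq; rewrite negb_exists => /forallP h.
    by apply/eqP/ffunP => i; move: (h i); rewrite negbK => /eqP->.
  by rewrite (bigD1 i) //= mxE (negbTE ni) mul0r.
apply/ffunP => y; rewrite sum_ffunE (bigD1 y) //= big1 => [|x neq].
  by rewrite addr0 ffunE pureE eqxx [_ *: _]mulr1.
by rewrite ffunE pureE (negbTE neq) scaler0.
Qed.

(* The library leaves the algebra structure of ['End(V)] non canonical, and its
   ready-made product is the reverse of composition; here the product of f and g
   is [(f \o g)%VF]. *)
Definition tend : Type := 'End(tpow).

HB.instance Definition _ := GRing.Lmodule.on tend.

Lemma tpow_proper : (0 < dim tpow)%N.
Proof. by rewrite [dim _]muln1; apply/card_gt0P; exists [ffun=> 0]. Qed.

HB.instance Definition _ := GRing.Zmodule_isNzRing.Build tend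
  (@comp_lfunA _ _ _ _ _) (@comp_lfun1l _ _ _) (@comp_lfun1r _ _ _)
  (@comp_lfunDl _ _ _ _) (@comp_lfunDr _ _ _ _) (lfun1_neq0 tpow_proper).

HB.instance Definition _ := GRing.Lmodule_isLalgebra.Build R[i] tend
  (fun a f g => comp_lfunZl a f g).

HB.instance Definition _ := GRing.Lalgebra_isAlgebra.Build R[i] tend
  (fun a f g => comp_lfunZr a f g).

Definition H1_equivariant : {pred tend} :=
  fun f => `[< forall (g : 'M[R[i]]_2) (t : tpow), H1 g -> f (diag_act g t) = diag_act g (f t) >].

Lemma H1_equivariantP (f : tend) :
  reflect (forall (g : 'M[R[i]]_2) (t : tpow), H1 g -> f (diag_act g t) = diag_act g (f t))
          (f \in H1_equivariant).
Proof. exact: asboolP. Qed.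

Lemma H1_equivariant_closed : GRing.subsemialg_closed H1_equivariant.
Proof.
have lin g := diag_act_linear g.
have act0 g : diag_act g 0 = 0.
  by have := lin g (-1) 0 0; rewrite scaler0 addr0 scaleN1r addNr.
split; [|split| |].
- by apply/H1_equivariantP => g t _; rewrite !id_lfunE.
- by apply/H1_equivariantP => g t _; rewrite !zero_lfunE act0.
- move=> f h /H1_equivariantP fH /H1_equivariantP hH.
  apply/H1_equivariantP => g t gH; rewrite !add_lfunE fH // hH //.
  by rewrite -[f t]scale1r lin !scale1r.
- move=> a f /H1_equivariantP fH; apply/H1_equivariantP => g t gH.
  by rewrite !scale_lfunE fH // -[a *: f t]addr0 lin act0 addr0.
move=> f h /H1_equivariantP fH /H1_equivariantP hH.
by apply/H1_equivariantP => g t gH; rewrite !comp_lfunE hH // fH.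
Qed.

HB.instance Definition _ :=
  GRing.isSubSemiAlgClosed.Build R[i] tend H1_equivariant H1_equivariant_closed.

Record centralizer := Centralizer {
  centralizer_val :> tend;
  _ : centralizer_val \in H1_equivariant
}.

HB.instance Definition _ := [isSub for centralizer_val].
HB.instance Definition _ := [Choice of centralizer by <:].
HB.instance Definition _ := [SubChoice_isSubAlgebra of centralizer by <:].

End TensorPower.

(* The sizes for k = 2m - 1 and k = 2m; they are natural numbers when m >= 1,
   although 2 ^ (m - 2) and 4 ^ (m - 2) are not when m = 1. *)
Section Sizes.
Variable m : nat.

Definition d_plus : rat := 2 ^ (m%:Z - 2) + 1 / 3 + 2 * 4 ^ (m%:Z - 2) / 3.
Definition d_minus : rat := - 2 ^ (m%:Z - 2) + 1 / 3 + 2 * 4 ^ (m%:Z - 2) / 3.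
Definition d_zero : rat := - (1 / 3) + 4 ^ (m%:Z - 1) / 3.
Definition e_plus : rat := 2 ^ (m%:Z - 2) + 2 * 4 ^ (m%:Z - 2).
Definition e_minus : rat := - 2 ^ (m%:Z - 2) + 2 * 4 ^ (m%:Z - 2).

End Sizes.

(* Main.v *)
Require Import Defs.
From HB Require Import structures.
From mathcomp Require Import all_boot all_order all_algebra.
From mathcomp Require Import boolp reals complex.
From mathcomp Require Import lra.

Set Implicit Arguments.
Unset Strict Implicit.
Unset Printing Implicit Defensive.

Import Order.TTheory GRing.Theory Num.Theory.
Local Open Scope ring_scope.

(** Write V for the natural representation, with weight basis e_0, e_1 for the
    diagonal generator D.  Up to a scalar, T is the matrix H with rows (1, 1)
    and (1, -1), and rescaling the action of a generator on a whole tensor power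
    does not change what commutes with it.  Modulo scalars the group is the
    octahedral group S_4.  So, after rescaling T and D by constants that depend
    on k only, the constituents of an even tensor power are among the five
    irreducible representations of S_4, and those of an odd power among the
    three representations V (x) U with U of degree 1 or 2.  Tensoring with V
    moves between these eight representations along the edges of the affine
    Dynkin diagram of type E_7,

      Triv - Spin - Rot - Spin4 - RotS - SpinS - Sgn,    with Std joined to Spin4.

    Hence the tensor power of order k is the direct sum, over the paths of
    length k in this graph that start at Triv, of the representation at the end
    of the path ([tpow_decomposes]); the multiplicities obey the recursion of
    the graph, which the closed formulas solve ([mult_even], [mult_odd]).

    All the representation theory is explicit, because D has distinct
    eigenvalues, all powers of i after rescaling, in each of the eight representations.  Each
    one is therefore given by a set of weights in Z/4 and an integral matrix for
    T in the weight basis, and the maps between U_j (x) V and its constituents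
    are integral tables, whose properties are finite computations ([CG_Tmx],
    [CG_orth], [CG_complete]).  Distinct eigenvalues also make Schur's lemma
    elementary: what commutes with D is diagonal, and then commutation with T
    forces the diagonal to be constant, or zero between different
    representations ([Schur_eq], [Schur_neq]).  So an equivariant endomorphism
    is the same thing as one scalar for each pair of paths with the same end,
    that is, one square matrix for each representation ([blockM], [block_inj],
    [block_surj]). *)

(** * Eight representations in weight coordinates *)

(** The degrees are 1, 1, 2, 3, 3 and 2, 2, 4.  Std is the representation of S_4
    through S_3, Rot the rotation representation, and the suffix S is the twist
    by the sign, which exchanges Triv and Sgn, Rot and RotS, Spin and SpinS. *)
Inductive irrep := Triv | Sgn | Std | Rot | RotS | Spin | SpinS | Spin4.

Definition irreps := [:: Triv; Sgn; Std; Rot; RotS; Spin; SpinS; Spin4].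

Definition irrep_code (j : irrep) : nat :=
  match j with
  | Triv => 0 | Sgn => 1 | Std => 2 | Rot => 3
  | RotS => 4 | Spin => 5 | SpinS => 6 | Spin4 => 7
  end.

Lemma irrep_codeK : cancel irrep_code (nth Triv irreps).
Proof. by case. Qed.

HB.instance Definition _ := Countable.copy irrep (can_type irrep_codeK).

Lemma irreps_enum : Finite.axiom irreps.
Proof. by case. Qed.

HB.instance Definition _ := isFinite.Build irrep irreps_enum.

Lemma sum_irrep (V : nmodType) (F : irrep -> V) :
  \sum_j F j = F Triv + (F Sgn + (F Std + (F Rot + (F RotS + (F Spin + (F SpinS + F Spin4)))))).
Proof.
have -> : \sum_j F j = \sum_(j <- irreps) F j.
  apply: perm_big; apply: uniq_perm => //; first exact: index_enum_uniq.
  by move=> j; rewrite mem_index_enum; case: j.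
by rewrite !big_cons big_nil addr0.
Qed.

(** The representations in the odd tensor powers. *)
Definition spin (j : irrep) : bool :=
  match j with Spin | SpinS | Spin4 => true | _ => false end.

(** The exponents a of the eigenvalues i^a of D.  The first one is chosen so that
    the row of T at this weight has no zero entry between weights of j; this is
    why Rot starts with 3. *)
Definition weights (j : irrep) : seq nat :=
  match j with
  | Triv => [:: 0] | Sgn => [:: 2] | Std => [:: 0; 2]
  | Rot => [:: 3; 0; 1] | RotS => [:: 1; 2; 3]
  | Spin => [:: 0; 1] | SpinS => [:: 2; 3] | Spin4 => [:: 0; 1; 2; 3]
  end%N.

(** The matrix of T between weight vectors; rows and columns are indexed by the
    weights 0, 1, 2, 3 and are cut after the last nonzero entry.  On the even
    representations it is twice the action of a transposition of S_4; on Spin,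
    SpinS and Spin4, which are V (x) Triv, V (x) Sgn and V (x) Std, it is the
    Kronecker product of that matrix and H. *)
Definition Trows (j : irrep) : seq (seq int) :=
  match j with
  | Triv => [:: [:: 2]]
  | Sgn => [:: [::]; [::]; [:: 0; 0; -2]]
  | Std => [:: [:: -1; 0; 1]; [::]; [:: 3; 0; 1]]
  | Rot => [:: [:: 0; 1; 0; -1]; [:: 2; -1; 0; -1]; [::]; [:: -2; -1; 0; -1]]
  | RotS => [:: [::]; [:: 0; 1; 2; 1]; [:: 0; 1; 0; -1]; [:: 0; 1; -2; 1]]
  | Spin => [:: [:: 2; 2]; [:: 2; -2]]
  | SpinS => [:: [::]; [::]; [:: 0; 0; -2; -2]; [:: 0; 0; -2; 2]]
  | Spin4 => [:: [:: -1; -1; 1; 1]; [:: -1; 1; 1; -1];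
                 [:: 3; 3; 1; 1]; [:: 3; -3; 1; -1]]
  end.

Definition Tent j (a b : nat) : int := nth 0 (nth [::] (Trows j) a) b.
Definition Eent j (a b : nat) : int := ((a == b) && (a \in weights j))%:R.

(** An embedding of U_j' in U_j (x) V sends the weight vector u'_a to a
    combination of some u_b (x) e_0 and some u_c (x) e_1; the two lists give
    the coefficients for a = 0, 1, 2, 3.  The two embeddings attached to an edge
    of the graph are normalized with respect to each other so that the constant
    12 in [CG_orth] is the same for all edges. *)
Definition CGtable (j j' : irrep) : seq int * seq int :=
  match j, j' with
  | Triv, Spin => ([:: 1], [:: 0; 1])
  | Sgn, SpinS => ([:: 0; 0; 1], [:: 0; 0; 0; 1])
  | Std, Spin4 => ([:: 1; 0; 1], [:: 0; 1; 0; 1])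
  | Rot, Spin => ([:: -1; -2], [:: 2; 1])
  | Rot, Spin4 => ([:: 1; -1; 0; -1], [:: 1; -1; 1; 0])
  | RotS, SpinS => ([:: 0; 0; -1; -2], [:: 0; 0; 2; 1])
  | RotS, Spin4 => ([:: 0; -3; -1; 1], [:: 3; 0; -1; 1])
  | Spin, Triv => ([:: -6], [:: 6])
  | SpinS, Sgn => ([:: 0; 0; -6], [:: 0; 0; 6])
  | Spin4, Std => ([:: -3; 0; -3], [:: 3; 0; 3])
  | Spin, Rot => ([:: -2; 0; 0; -2], [:: -2; -2])
  | SpinS, RotS => ([:: 0; -2; -2], [:: 0; 0; -2; -2])
  | Spin4, Rot => ([:: 2; -3; 0; -1], [:: 2; -1; 0; -3])
  | Spin4, RotS => ([:: 0; 1; -2; -1], [:: 0; -1; -2; 1])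
  | _, _ => ([::], [::])
  end.

Definition adj (j j' : irrep) : bool :=
  match j, j' with
  | Triv, Spin | Sgn, SpinS | Std, Spin4 => true
  | Rot, (Spin | Spin4) | RotS, (SpinS | Spin4) => true
  | Spin, (Triv | Rot) | SpinS, (Sgn | RotS) | Spin4, (Std | Rot | RotS) => true
  | _, _ => false
  end.

(** The coefficient of u_b (x) e_0 or u_b (x) e_1, according to e, in the image
    of u'_a.  On V (x) V the weights are 0, 1, 1, 2 and the antisymmetric line has
    weight 1; to give it the weight 0 of Triv, weights are lowered by 1 at each
    step from odd to even powers. *)
Definition CGent (e : bool) j j' (b a : nat) : int :=
  if (b + e == a + spin j %[mod 4])%N then nth 0 (if e then (CGtable j j').2 else (CGtable j j').1) a
  else 0.

(** * Embeddings and projections between neighbours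

    Identities between the integral matrices below are decided by computing the
    entries. *)

Definition mx4 (f : nat -> nat -> int) : 'M[int]_4 := \matrix_(a < 4, b < 4) f a b.

Definition eq4 (f g : nat -> nat -> int) : bool :=
  all (fun a => all (fun b => f a b == g a b) (iota 0 4)) (iota 0 4).

Lemma mx4_eq f g : eq4 f g -> mx4 f = mx4 g.
Proof.
move=> /allP fg; apply/matrixP => a b; rewrite !mxE.
by apply/eqP/(allP (fg a _)); rewrite mem_iota ltn_ord.
Qed.

Lemma mx4_mul f g : mx4 f *m mx4 g =
  mx4 (fun a b => f a 0 * g 0 b + (f a 1 * g 1 b + (f a 2 * g 2 b + f a 3 * g 3 b))).
Proof. by apply/matrixP => a b; rewrite !mxE !big_ord_recl big_ord0 !mxE addr0. Qed.

Lemma mx4_add f g : mx4 f + mx4 g = mx4 (fun a b => f a b + g a b).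
Proof. by apply/matrixP => a b; rewrite !mxE. Qed.

Lemma mx4_scale c f : c *: mx4 f = mx4 (fun a b => c * f a b).
Proof. by apply/matrixP => a b; rewrite !mxE. Qed.

Lemma mx4_0 : 0 = mx4 (fun _ _ => 0).
Proof. by apply/matrixP => a b; rewrite !mxE. Qed.

Definition mx4E := (mx4_mul, mx4_scale, mx4_add, mx4_0).

Definition Tmx j := mx4 (Tent j).
Definition Emx j := mx4 (Eent j).
Definition CG e j j' := mx4 (CGent e j j').

(** The antisymmetric form on V (x) V is invariant up to a character.  Contracting
    with it turns the embedding of U_j in U_j' (x) V into a projection from
    U_j (x) V to U_j': this exchanges e_0 and e_1 and changes one sign.  The
    degree of U_j' is the normalization, as seen on traces. *)
Definition CGdual e j j' : 'M[int]_4 :=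
  ((-1) ^+ (spin j (+) e) * (size (weights j'))%:Z) *: CG (~~ e) j' j.

Lemma Emx_idem j : Emx j *m Emx j = Emx j.
Proof. by rewrite /Emx mx4E; apply: mx4_eq; case: j; vm_compute. Qed.

Lemma Emx_Tmx j : Emx j *m Tmx j = Tmx j.
Proof. by rewrite /Emx mx4E; apply: mx4_eq; case: j; vm_compute. Qed.

Lemma Tmx_Emx j : Tmx j *m Emx j = Tmx j.
Proof. by rewrite /Emx mx4E; apply: mx4_eq; case: j; vm_compute. Qed.

Lemma Emx_CG e j j' : Emx j *m CG e j j' = CG e j j'.
Proof. by rewrite /Emx mx4E; apply: mx4_eq; case: e; case: j; case: j'; vm_compute. Qed.

Lemma CG_Emx e j j' : CG e j j' *m Emx j' = CG e j j'.
Proof. by rewrite /Emx mx4E; apply: mx4_eq; case: e; case: j; case: j'; vm_compute. Qed.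

Lemma Emx_CGdual e j j' : Emx j' *m CGdual e j j' = CGdual e j j'.
Proof. by rewrite -scalemxAr Emx_CG. Qed.

Lemma CGdual_Emx e j j' : CGdual e j j' *m Emx j = CGdual e j j'.
Proof. by rewrite -scalemxAl CG_Emx. Qed.

Lemma CG_nadj e j j' : ~~ adj j j' -> CG e j j' = 0.
Proof.
move=> nadj; rewrite /CG mx4E; apply: mx4_eq; move: nadj; apply/implyP.
by case: e; case: j; case: j'; vm_compute.
Qed.

Lemma adj_spin j j' : adj j j' -> spin j' = ~~ spin j.
Proof. by apply: contraTeq; case: j; case: j'. Qed.

(** The embeddings commute with T, as H acts on V by e_0 |-> e_0 + e_1 and
    e_1 |-> e_0 - e_1.  From odd to even powers a factor -2 appears, the
    eigenvalue of H (x) H on the antisymmetric line. *)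
Lemma CG_Tmx (e : bool) j j' : adj j j' ->
  Tmx j *m CG false j j' + (-1) ^+ e *: (Tmx j *m CG true j j') =
  (if spin j then -2 else 1) *: (CG e j j' *m Tmx j').
Proof.
move=> jj'; rewrite /Tmx !mx4E; apply: mx4_eq; move: jj'; apply/implyP.
by case: e; case: j; case: j'; vm_compute.
Qed.

(** With [CG_complete], this says that U_j (x) V is the direct sum of the
    neighbours of U_j. *)
Lemma CG_orth j j1 j2 : adj j j1 ->
  CGdual false j j1 *m CG false j j2 + CGdual true j j1 *m CG true j j2 =
  (12 * (j1 == j2)%:R) *: Emx j1.
Proof.
move=> jj; rewrite /CGdual -!scalemxAl !mx4E; apply: mx4_eq; move: jj; apply/implyP.
by case: j; case: j1; case: j2; vm_compute.
Qed.

Lemma CG_complete e e' j :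
  \sum_j' CG e j j' *m CGdual e' j j' = (12 * (e == e')%:R) *: Emx j.
Proof.
rewrite sum_irrep /CGdual -!scalemxAr !mx4E; apply: mx4_eq.
by case: e; case: e'; case: j; vm_compute.
Qed.

(** * Schur's lemma in weight coordinates *)

Definition base (j : irrep) : 'I_4 := inord (head 0%N (weights j)).

Lemma val_base j : base j = head 0%N (weights j) :> nat.
Proof. by rewrite inordK //; case: j. Qed.

Lemma base_mem j : val (base j) \in weights j.
Proof. by rewrite /= val_base; case: j. Qed.

(** The entries of T from a basic weight make an endomorphism constant. *)
Lemma Tent_base j b : b \in weights j -> Tent j (base j) b != 0.
Proof.
rewrite val_base; apply/allP: b.
by case: j; vm_compute.
Qed.

(** The eight sets of weights are distinct, and the entries of T off the
    diagonal, between weights of the representation, are nonzero.  So any common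
    weight of two different representations is linked by T to a weight that only
    one of them has. *)
Lemma Tent_sep i j a : i != j -> a \in weights i -> a \in weights j ->
  exists b : 'I_4, ((val b \notin weights i) && (Tent j a b != 0))
          || ((val b \notin weights j) && (Tent i b a != 0)).
Proof.
move=> ij ai aj.
suff /hasP[b] : has (fun b => ((b \notin weights i) && (Tent j a b != 0))
          || ((b \notin weights j) && (Tent i b a != 0))) (iota 0 4).
  by rewrite mem_iota => b4 ?; exists (Ordinal b4).
have /allP/(_ a ai)/implyP/(_ aj) // : all (fun a => (a \in weights j) ==>
   has (fun b => ((b \notin weights i) && (Tent j a b != 0))
          || ((b \notin weights j) && (Tent i b a != 0))) (iota 0 4)) (weights i).
by move: ij {aj ai}; apply/implyP; case: i; case: j; vm_compute.
Qed.

Section Complex.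
Variable R : realType.
Local Notation F := R[i].
Local Notation toF := (map_mx (intr : int -> F)).

Definition Wmx : 'M[F]_4 := \matrix_(a, b) (if a == b then 'i%C ^+ a else 0).

Lemma expi4 n : 'i%C ^+ n = 'i%C ^+ (n %% 4) :> F.
Proof.
rewrite {1}(divn_eq n 4) exprD mulnC exprM.
by rewrite -[4%N]/(2 * 2)%N exprM sqr_i sqrrN !expr1n mul1r.
Qed.

Lemma neq1N1 : 1 != -1 :> F.
Proof. by rewrite -subr_eq0 opprK (pnatr_eq0 _ 2). Qed.

Lemma expi_neq0 n : 'i%C ^+ n != 0 :> F.
Proof.
apply/expf_neq0/eqP => /(congr1 (fun x => x ^+ 2)).
by rewrite sqr_i expr0n => /eqP; rewrite oppr_eq0 oner_eq0.
Qed.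

Lemma expi_inj (a b : 'I_4) : 'i%C ^+ a = 'i%C ^+ b :> F -> a = b.
Proof.
move=> e; apply: val_inj; move: e.
have h1 := neq1N1.
have hi : 'i%C != 0 :> F by apply: (expi_neq0 1).
have h2 : 'i%C != 1 :> F.
  by apply/eqP => /(congr1 (fun x => x ^+ 2)); rewrite sqr_i expr1n => /esym/eqP; apply/negP.
have h3 : 'i%C != -1 :> F.
  by apply/eqP => /(congr1 (fun x => x ^+ 2)); rewrite sqr_i sqrrN expr1n => /esym/eqP; apply/negP.
have h4 : - 'i%C != 1 :> F by rewrite eqr_oppLR.
have h5 : 'i%C != - 'i%C :> F by rewrite -subr_eq0 opprK -mulr2n mulrn_eq0.
have s3 : 'i%C ^+ 3 = - 'i%C :> F by rewrite exprS sqr_i mulrN1.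
case: a b => [[|[|[|[|//]]]] ?] [[|[|[|[|//]]]] ?] //=;
  rewrite ?expr0 ?expr1 ?sqr_i ?s3 => /eqP;
  by rewrite ?(negPf h1) ?(negPf h2) ?(negPf h3) ?(negPf h4) ?(negPf h5)
     1?[_ == _]eq_sym ?(negPf h1) ?(negPf h2) ?(negPf h3) ?(negPf h4) ?(negPf h5)
     ?eqr_opp ?(negPf h1) ?(negPf h2) 1?[_ == _]eq_sym ?(negPf h1) ?(negPf h2).
Qed.

Lemma Emx_outr j (f : 'M[F]_4) (b : 'I_4) :
  f *m toF (Emx j) = f -> val b \notin weights j -> f b b = 0.
Proof.
move=> <- bj; rewrite mxE big1 // => c _; rewrite !mxE /Eent.
by case: eqP => [->|]; rewrite ?(negPf bj) mulr0.
Qed.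

Lemma Emx_outl j (f : 'M[F]_4) (b : 'I_4) :
  toF (Emx j) *m f = f -> val b \notin weights j -> f b b = 0.
Proof.
by move=> <- bj; rewrite mxE big1 // => c _; rewrite !mxE /Eent (negPf bj) andbF mul0r.
Qed.

Lemma CG_Wmx (e : bool) j j' :
  'i%C ^+ e *: (Wmx *m toF (CG e j j')) = 'i%C ^+ spin j *: (toF (CG e j j') *m Wmx).
Proof.
apply/matrixP => b a; rewrite !mxE.
rewrite (bigD1 b) //= big1 => [|c cb]; last by rewrite mxE eq_sym (negPf cb) mul0r.
rewrite (bigD1 a) //= big1 => [|c ca]; last by rewrite [X in _ * X]mxE (negPf ca) mulr0.
rewrite !mxE !eqxx !addr0 /CGent; case: eqP => [ab|_]; last by rewrite rmorph0 !(mul0r, mulr0).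
by rewrite mulrA -exprD mulrCA -exprD mulrC addnC expi4 ab [in RHS]addnC -expi4.
Qed.

Section Schur.
Variables (i j : irrep) (f : 'M[F]_4).
Hypotheses (fEl : toF (Emx i) *m f = f) (fEr : f *m toF (Emx j) = f).
Hypotheses (fT : toF (Tmx i) *m f = f *m toF (Tmx j)) (fD : Wmx *m f = f *m Wmx).

Lemma commWmx_diag a b : a != b -> f a b = 0.
Proof.
move=> ab; move/matrixP: fD => /(_ a b); rewrite !mxE.
rewrite (bigD1 a) //= big1 => [|c ca]; last by rewrite mxE eq_sym (negPf ca) mul0r.
rewrite (bigD1 b) //= big1 => [|c cb]; last by rewrite mxE (negPf cb) mulr0.
rewrite !mxE !eqxx !addr0 mulrC => /eqP; rewrite -subr_eq0 -mulrBr mulf_eq0 => /orP[/eqP//|].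
by rewrite subr_eq0 => /eqP/expi_inj/eqP; rewrite (negPf ab).
Qed.

Lemma commT_diag (a b : 'I_4) : (Tent i a b)%:~R * f b b = f a a * (Tent j a b)%:~R.
Proof.
move/matrixP: fT => /(_ a b); rewrite !mxE.
rewrite (bigD1 b) //= big1 => [|c ca]; last by rewrite commWmx_diag ?mulr0.
rewrite (bigD1 a) //= big1 => [|c cb]; last by rewrite commWmx_diag ?mul0r // eq_sym.
by rewrite !mxE !addr0.
Qed.

(** An intertwiner vanishes on a weight that only one side has; through T it
    then vanishes on every common weight. *)
Lemma Schur_neq : i != j -> f = 0.
Proof.
move=> ij; apply/matrixP => a a'; rewrite mxE.
have [<-{a'}|aa'] := eqVneq a a'; last exact: commWmx_diag.
case ai : (val a \in weights i); last by apply: (Emx_outl fEl); rewrite ai.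
case aj : (val a \in weights j); last by apply: (Emx_outr fEr); rewrite aj.
have [b /orP[]/andP[bS nz]] := Tent_sep ij ai aj.
  have /esym/eqP := commT_diag a b.
  by rewrite (Emx_outl fEl bS) mulr0 mulf_eq0 intr_eq0 (negPf nz) orbF => /eqP.
have /eqP := commT_diag b a.
by rewrite (Emx_outr fEr bS) mul0r mulf_eq0 intr_eq0 (negPf nz) => /eqP.
Qed.

Lemma Schur_eq : i = j -> f = f (base j) (base j) *: toF (Emx j).
Proof.
move=> ij; apply/matrixP => a a'; rewrite !mxE /Eent.
have [<-{a'}|aa'] := eqVneq a a'; last first.
  by rewrite commWmx_diag //; move: aa'; rewrite -val_eqE /= => /negPf->; rewrite mulr0.
rewrite eqxx /=; case aj : (_ \in _); last by rewrite mulr0 (Emx_outr fEr) //= aj.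
rewrite mulr1; have := commT_diag (base j) a; rewrite ij [RHS]mulrC.
by apply: mulfI; rewrite intr_eq0 Tent_base.
Qed.

End Schur.

(** * Decomposition of the tensor powers along paths *)

(** This is 2 ^ k, written so that the matrices of order [tdim k.+1] are literally
    two by two block matrices. *)
Fixpoint tdim (k : nat) : nat := if k is k'.+1 then tdim k' + tdim k' else 1.

Fixpoint kronpow (g : 'M[F]_2) (k : nat) : 'M[F]_(tdim k) :=
  if k is k'.+1 then
    block_mx (g 0 0 *: kronpow g k') (g 0 1 *: kronpow g k')
             (g 1 0 *: kronpow g k') (g 1 1 *: kronpow g k')
  else 1%:M.

(** A decomposition of the k-th tensor power into representations indexed by the
    set A: injections and projections that intertwine T and D up to the scalars
    t and s.  Each summand is embedded in four-dimensional weight coordinates,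
    cut down to its weights by [Emx]. *)
Record decomposition (k : nat) (I : finType) (A : {set I}) (lab : I -> irrep)
  (inj : I -> 'M[F]_(tdim k, 4)) (pr : I -> 'M[F]_(4, tdim k)) (t s : F) : Prop :=
Decomposition {
  dec_spin : forall p, p \in A -> spin (lab p) = odd k;
  dec_orth : forall p q, p \in A -> q \in A ->
    pr p *m inj q = (p == q)%:R *: toF (Emx (lab p));
  dec_complete : \sum_(p in A) inj p *m pr p = 1%:M;
  dec_injE : forall p, inj p *m toF (Emx (lab p)) = inj p;
  dec_prE : forall p, toF (Emx (lab p)) *m pr p = pr p;
  dec_t : t != 0;
  dec_T : forall p, p \in A -> kronpow (mxT R) k *m inj p = t *: (inj p *m toF (Tmx (lab p)));
  dec_s : s != 0;
  dec_D : forall p, p \in A -> kronpow (mxD R) k *m inj p = s *: (inj p *m Wmx)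
}.

Lemma sum_col_row (I : finType) (P : pred I) m n (u v : I -> 'M[F]_(m, n)) (a b : I -> 'M[F]_(n, m)) :
  \sum_(x | P x) col_mx (u x) (v x) *m row_mx (a x) (b x) =
  block_mx (\sum_(x | P x) u x *m a x) (\sum_(x | P x) u x *m b x)
           (\sum_(x | P x) v x *m a x) (\sum_(x | P x) v x *m b x).
Proof.
under eq_bigr do rewrite mul_col_row.
elim: (index_enum I) => [|x r IH]; first by rewrite !big_nil block_mx0.
by rewrite !big_cons; case: (P x); rewrite IH ?add_block_mx.
Qed.

(** One more tensor factor: each summand U_j of the k-th power is replaced by
    its neighbours, embedded in U_j (x) V.  The first and second blocks are the
    components along e_0 and e_1 of the new factor, which is written last here
    and comes first in the indexing of tensors by words. *)
Section Step.
Variables (k : nat) (I : finType) (A : {set I}) (lab : I -> irrep).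
Variables (inj : I -> 'M[F]_(tdim k, 4)) (pr : I -> 'M[F]_(4, tdim k)) (t s : F).

Definition stepA : {set I * irrep} := [set x | (x.1 \in A) && adj (lab x.1) x.2].

Definition step_part (e : bool) (x : I * irrep) : 'M[F]_(tdim k, 4) :=
  inj x.1 *m toF (CG e (lab x.1) x.2).

Definition step_copart (e : bool) (x : I * irrep) : 'M[F]_(4, tdim k) :=
  12^-1 *: (toF (CGdual e (lab x.1) x.2) *m pr x.1).

Definition step_inj x : 'M[F]_(tdim k.+1, 4) :=
  col_mx (step_part false x) (step_part true x).

Definition step_pr x : 'M[F]_(4, tdim k.+1) :=
  row_mx (step_copart false x) (step_copart true x).

Hypothesis dec : decomposition A lab inj pr t s.

Lemma natF12 : 12 != 0 :> F. Proof. by rewrite pnatr_eq0. Qed.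

Lemma step_complete_part e e' :
  \sum_(x in stepA) step_part e x *m step_copart e' x = ((e == e')%:R)%:M.
Proof.
rewrite (eq_bigl (fun x => (x.1 \in A) && adj (lab x.1) x.2)) => [|x]; last by rewrite inE.
rewrite -(pair_big_dep (mem A) (fun p j => adj (lab p) j) (fun p j => step_part e (p, j) *m step_copart e' (p, j))) /=.
rewrite -scalemx1 -(dec_complete dec) scaler_sumr; apply: eq_bigr => p pA.
have -> : (e == e')%:R *: (inj p *m pr p) =
   inj p *m (12^-1 *: toF (\sum_j CG e (lab p) j *m CGdual e' (lab p) j)) *m pr p.
  rewrite CG_complete map_mxZ scalerA rmorphM /= !rmorph_nat mulrA mulVf ?natF12 // mul1r.
  by rewrite -scalemxAr (dec_injE dec) scalemxAl.
rewrite raddf_sum scaler_sumr mulmx_sumr mulmx_suml [RHS](bigID (adj (lab p))) /=.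
rewrite [X in _ = _ + X]big1 ?addr0 => [|j nadj]; last first.
  by rewrite CG_nadj // mul0mx raddf0 scaler0 mulmx0 mul0mx.
apply: eq_bigr => j _; rewrite /step_part /step_copart /= map_mxM.
by rewrite -!scalemxAr -scalemxAl !mulmxA.
Qed.

(** The entries of T are c, c, c, -c for a constant c, which is absorbed in the
    scalar of the next power. *)
Lemma dec_step :
  decomposition stepA (fun x => x.2) step_inj step_pr
    (t * mxT R 0 0 * (if odd k then -2 else 1)) (s * 'i%C ^+ odd k).
Proof.
have nzT : mxT R 0 0 != 0.
  rewrite mxE mxE mulr1 mulf_neq0 ?invr_eq0 ?pnatr_eq0 //.
  rewrite addrC addr_eq0; apply/eqP => /(congr1 (fun x => x ^+ 2)).
  by rewrite sqr_i sqrrN expr1n => /esym/eqP; apply/negP/neq1N1.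
split.
- by move=> [p j]; rewrite inE /= => /andP[pA /adj_spin->]; rewrite (dec_spin dec pA).
- move=> [p j] [q l]; rewrite !inE /= => /andP[pA pj] /andP[qA ql].
  rewrite mul_row_col /step_copart /step_part /= -!scalemxAl -scalerDr.
  have E u v : u *m pr p *m (inj q *m v) = (p == q)%:R *: (u *m toF (Emx (lab p)) *m v).
    by rewrite -!mulmxA [pr p *m _]mulmxA (dec_orth dec) // -scalemxAl -scalemxAr.
  rewrite !E -!map_mxM /= !CGdual_Emx.
  have [<-{q E ql qA}|pq] := eqVneq p q; last first.
    by rewrite !scale0r addr0 scaler0 xpair_eqE (negPf pq) scale0r.
  rewrite !scale1r -map_mxD CG_orth // map_mxZ scalerA rmorphM /= !rmorph_nat mulrA mulVf ?natF12 //.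
  by rewrite mul1r xpair_eqE eqxx.
- apply: etrans (sum_col_row (fun x => x \in stepA) (step_part false) (step_part true) (step_copart false) (step_copart true)) _.
  apply: etrans (esym (@scalar_mx_block _ (tdim k) (tdim k) 1)).
  have z : 0 = (0%:R)%:M :> 'M[F]_(tdim k) by rewrite raddf0.
  by congr block_mx; apply: etrans (step_complete_part _ _) _; rewrite -?z.
- move=> [p j] /=; rewrite mul_col_mx /step_part /= -!mulmxA -!map_mxM.
  by rewrite /= !CG_Emx.
- move=> [p j] /=; rewrite mul_mx_row /step_copart /= -!scalemxAr !mulmxA -!map_mxM.
  by rewrite /= !Emx_CGdual.
- by rewrite !mulf_neq0 ?(dec_t dec) //; case: odd; rewrite ?oner_neq0 ?oppr_eq0 ?pnatr_eq0.
- move=> [p j]; rewrite inE /= => /andP[pA pj].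
  rewrite /step_inj /step_part mul_block_col /= mul_col_mx -!scalemxAl !mulmxA.
  rewrite (dec_T dec pA) -!scalemxAl -!mulmxA -!map_mxM /=.
  have e b := congr1 toF (CG_Tmx b pj).
  move: (e false) (e true); rewrite !map_mxD !map_mxZ /=.
  move: (toF _) (toF _) (toF _) (toF _) => X Y Z0 Z1.
  rewrite expr0 expr1 rmorphN1 rmorph1 scale1r scaleN1r -(dec_spin dec pA).
  have -> : (if spin (lab p) then -2 else 1 : int)%:~R = (if spin (lab p) then -2 else 1) :> F.
    by case: spin; rewrite ?rmorphN ?rmorph1 ?rmorph_nat.
  move=> e0 e1.
  have [-> [-> ->]] : mxT R 0 1 = mxT R 0 0 /\ mxT R 1 0 = mxT R 0 0 /\ mxT R 1 1 = - mxT R 0 0.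
    by rewrite !mxE /= mulr1 mulrN1.
  rewrite scaleNr -!scalerBr -!scalerDr -mulmxDr -mulmxBr e0 e1 -!scalemxAr !scalerA.
  by rewrite -scale_col_mx ![_ * t]mulrC.
- by rewrite mulf_neq0 ?(dec_s dec) ?expi_neq0.
- move=> [p j]; rewrite inE /= => /andP[pA pj].
  rewrite /step_inj /step_part mul_block_col /= mul_col_mx -!scalemxAl !mulmxA.
  rewrite (dec_D dec pA) -!scalemxAl -!mulmxA -(dec_spin dec pA).
  have e (b : bool) := CG_Wmx b (lab p) j.
  have [-> [-> [-> ->]]] : mxD R 0 0 = 1 /\ mxD R 0 1 = 0 /\ mxD R 1 0 = 0 /\ mxD R 1 1 = 'i%C.
    by rewrite !mxE /=.
  have f (b : bool) : 'i%C ^+ b *: (s *: (inj p *m (Wmx *m toF (CG b (lab p) j)))) =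
      (s * 'i%C ^+ spin (lab p)) *: (inj p *m (toF (CG b (lab p) j) *m Wmx)).
    by rewrite -[RHS]scalerA (scalemxAr ('i%C ^+ spin _)) -e -scalemxAr !scalerA [s * _]mulrC.
  move: (f false) (f true); rewrite expr0 expr1 scale1r => f0 f1.
  by rewrite !scale0r add0r addr0 f0 f1 -scale_col_mx.
Qed.

End Step.

(** The number of paths of length k from Triv to j in the graph. *)
Fixpoint mult (k : nat) (j : irrep) : nat :=
  if k is k'.+1 then \sum_(i | adj i j) mult k' i else j == Triv.

Lemma tpow_decomposes k : exists (I : finType) (A : {set I}) (lab : I -> irrep)
    (inj : I -> 'M[F]_(tdim k, 4)) (pr : I -> 'M[F]_(4, tdim k)) (t s : F),
  decomposition A lab inj pr t s /\ forall j, #|[set p in A | lab p == j]| = mult k j.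
Proof.
elim: k => [|k [I [A [lab [inj [pr [t [s [dec cnt]]]]]]]]]; last first.
  exists (I * irrep)%type, (stepA A lab), (fun x => x.2), (step_inj lab inj), (step_pr lab pr).
  do 2!eexists; split; first exact: dec_step dec.
  move=> j /=; rewrite -sum1_card.
  rewrite (eq_bigl (fun x => (x.1 \in A) && (adj (lab x.1) x.2 && (x.2 == j)))) => [|x].
    rewrite -(pair_big_dep (mem A) (fun p l => adj (lab p) l && (l == j)) (fun _ _ => 1%N)) /=.
    rewrite (eq_bigr (fun p => (adj (lab p) j : nat))) => [|p _]; last first.
      case pj: (adj _ j); last first.
        by rewrite big_pred0 // => l; case: eqP => [->|]; rewrite ?pj ?andbF.
      by rewrite (big_pred1 j) // => l /=; case: eqP => [->|]; rewrite ?pj ?andbF.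
    rewrite -big_mkcondr /= (partition_big lab (fun i => adj i j)) /= => [|p /andP[]//].
    apply: eq_bigr => i ij; rewrite -cnt -sum1_card; apply: eq_bigl => p.
    by rewrite inE; case: eqP => [->|]; rewrite ?ij ?andbT ?andbF.
  by rewrite !inE andbA.
(* T is normalized to act by 2 on Triv, whence the scalar 1/2. *)
exists unit, setT, (fun=> Triv), (fun=> delta_mx 0 0), (fun=> delta_mx 0 0), 2^-1, 1.
have E : toF (Emx Triv) = delta_mx 0 0.
  by apply/matrixP => -[[|[|[|[|//]]]] ?] [[|[|[|[|//]]]] ?]; rewrite !mxE.
split=> [|j]; last first.
  have [->|ne] := eqVneq j Triv.
    by apply: etrans card_unit; apply: eq_card => p; rewrite !inE.
  by rewrite /= (negPf ne); apply: eq_card0 => p; rewrite !inE.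
split=> //=.
- by move=> [] [] _ _; rewrite mul_delta_mx E scale1r.
- by rewrite (big_pred1 tt) => [|[]]; rewrite ?inE // mul_delta_mx; apply/matrixP => a b; rewrite !mxE !ord1.
- by rewrite E mul_delta_mx.
- by rewrite E mul_delta_mx.
- by rewrite invr_eq0 pnatr_eq0.
- move=> _ _; rewrite mul1mx.
  have -> : toF (Tmx Triv) = 2 *: delta_mx 0 0.
    apply/matrixP => -[[|[|[|[|//]]]] ?] [[|[|[|[|//]]]] ?];
    by rewrite !mxE /Tent /= ?(mulr0, mulr1) ?rmorph_nat.
  by rewrite -scalemxAr scalerA mul_delta_mx mulVf ?pnatr_eq0 // scale1r.
- by rewrite oner_neq0.
- move=> _ _; rewrite mul1mx scale1r; apply/matrixP => a b; rewrite !mxE (bigD1 0) //= big1.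
    by rewrite !mxE !ord1 eqxx mul1r addr0 eq_sym; case: eqP => // <-.
  by move=> c c0; rewrite !mxE (negPf c0) andbF mul0r.
Qed.

End Complex.

(** * The commutant as an algebra of block matrices *)

Section Blocks.
Variable R : realType.
Local Notation F := R[i].
Local Notation toF := (map_mx (intr : int -> F)).
Variables (k : nat) (I : finType) (A : {set I}) (lab : I -> irrep).
Variables (inj : I -> 'M[F]_(tdim k, 4)) (pr : I -> 'M[F]_(4, tdim k)) (t s : F).
Hypothesis dec : decomposition A lab inj pr t s.

Definition intertwines (X : 'M[F]_(tdim k)) :=
  X *m kronpow (mxT R) k = kronpow (mxT R) k *m X /\ X *m kronpow (mxD R) k = kronpow (mxD R) k *m X.

(** The projections are inverse to the injections, so they intertwine whatever
    the injections intertwine. *)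
Lemma dec_pr_adjoint (Y : 'M[F]_(tdim k)) (Z : irrep -> 'M[F]_4) (c : F) :
    (forall p, p \in A -> Y *m inj p = c *: (inj p *m Z (lab p))) ->
    (forall j, toF (Emx j) *m Z j = Z j *m toF (Emx j)) ->
  forall p, p \in A -> pr p *m Y = c *: (Z (lab p) *m pr p).
Proof.
move=> YZ EZ p pA; rewrite -[LHS]mulmx1 -(dec_complete dec) mulmx_sumr (bigD1 p) //=.
rewrite big1 => [|q /andP[qA qp]]; last first.
  rewrite -mulmxA (mulmxA Y) YZ // -!scalemxAl -scalemxAr !mulmxA (dec_orth dec) //.
  by rewrite eq_sym (negPf qp) scale0r !mul0mx scaler0.
rewrite -mulmxA (mulmxA Y) YZ // -!scalemxAl -scalemxAr !mulmxA (dec_orth dec) //.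
by rewrite eqxx scale1r addr0 EZ -mulmxA (dec_prE dec).
Qed.

Lemma Emx_Wmx j : toF (Emx j) *m Wmx R = Wmx R *m toF (Emx j).
Proof.
apply/matrixP => a b; rewrite !mxE.
rewrite (bigD1 b) //= big1 => [|c cb]; last by rewrite [X in _ * X]mxE (negPf cb) mulr0.
rewrite (bigD1 a) //= big1 => [|c ca]; last by rewrite mxE eq_sym (negPf ca) mul0r.
rewrite !mxE !eqxx /Eent !addr0; case: eqP => [/val_inj->|_]; first by rewrite mulrC.
by rewrite rmorph0 mulr0 mul0r.
Qed.

Lemma dec_prT p : p \in A -> pr p *m kronpow (mxT R) k = t *: (toF (Tmx (lab p)) *m pr p).
Proof.
apply: (dec_pr_adjoint (Z := fun j => toF (Tmx j))) => [q qA|j]; first by rewrite (dec_T dec).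
by rewrite -!map_mxM /= Emx_Tmx Tmx_Emx.
Qed.

Lemma dec_prD p : p \in A -> pr p *m kronpow (mxD R) k = s *: (Wmx R *m pr p).
Proof.
apply: (dec_pr_adjoint (Z := fun=> Wmx R)) => [q qA|j]; [by rewrite (dec_D dec) | exact: Emx_Wmx].
Qed.

(** The scalar by which X maps the summand q to the summand p, read off at the
    basic weight. *)
Definition coef (X : 'M[F]_(tdim k)) (p q : I) : F :=
  (pr p *m X *m inj q) (base (lab p)) (base (lab p)).

Section SchurBlock.
Variables (X : 'M[F]_(tdim k)) (p q : I).
Hypotheses (cX : intertwines X) (pA : p \in A) (qA : q \in A).

Let fEl : toF (Emx (lab p)) *m (pr p *m X *m inj q) = pr p *m X *m inj q.
Proof. by rewrite !mulmxA (dec_prE dec). Qed.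

Let fEr : pr p *m X *m inj q *m toF (Emx (lab q)) = pr p *m X *m inj q.
Proof. by rewrite -!mulmxA (dec_injE dec). Qed.

Let fT : toF (Tmx (lab p)) *m (pr p *m X *m inj q) =
  pr p *m X *m inj q *m toF (Tmx (lab q)).
Proof.
apply: (scalerI (dec_t dec)); rewrite !mulmxA scalemxAl scalemxAl -(dec_prT pA).
by rewrite -(mulmxA (pr p) _ X) -(proj1 cX) -!mulmxA (dec_T dec qA) -!scalemxAr.
Qed.

Let fD : Wmx R *m (pr p *m X *m inj q) = pr p *m X *m inj q *m Wmx R.
Proof.
apply: (scalerI (dec_s dec)); rewrite !mulmxA scalemxAl scalemxAl -(dec_prD pA).
by rewrite -(mulmxA (pr p) _ X) -(proj2 cX) -!mulmxA (dec_D dec qA) -!scalemxAr.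
Qed.

Lemma coef_neq : lab p != lab q -> pr p *m X *m inj q = 0.
Proof. exact: Schur_neq fEl fEr fT fD. Qed.

Lemma coef_eq : lab p = lab q -> pr p *m X *m inj q = coef X p q *: toF (Emx (lab p)).
Proof. by move=> pq; rewrite /coef [LHS](Schur_eq fEr fT fD pq) pq. Qed.

End SchurBlock.

Definition summands j := [set p in A | lab p == j].

Lemma summandsP j p : reflect (p \in A /\ lab p = j) (p \in summands j).
Proof. by rewrite inE; apply: (iffP andP) => -[? /eqP]. Qed.

Definition block j (X : 'M[F]_(tdim k)) : 'M[F]_(#|summands j|) :=
  \matrix_(a, b) coef X (enum_val a) (enum_val b).

Lemma block_linear j : linear (block j).
Proof.
move=> c X Y; apply/matrixP => a b; rewrite !mxE /coef mulmxDr mulmxDl.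
by rewrite -scalemxAr -scalemxAl !mxE.
Qed.

Lemma Emx_base j : toF (Emx j) (base j) (base j) = 1.
Proof. by rewrite !mxE /Eent eqxx base_mem. Qed.

Lemma block1 j : block j 1%:M = 1%:M.
Proof.
apply/matrixP => a b; rewrite !mxE /coef mulmx1.
have /summandsP[aA aj] := enum_valP a; have /summandsP[bA bj] := enum_valP b.
by rewrite (dec_orth dec) // mxE Emx_base mulr1 (inj_eq enum_val_inj).
Qed.

(** Inserting the decomposition of the identity between X and Y, Schur's lemma
    kills the summands of another type and makes the others multiply as scalars. *)
Lemma blockM j X Y : intertwines X -> intertwines Y ->
  block j (X *m Y) = block j X *m block j Y.
Proof.
move=> cX cY; apply/matrixP => a b; rewrite !mxE.
have /summandsP[aA aj] := enum_valP a; have /summandsP[bA bj] := enum_valP b.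
under [RHS]eq_bigr do rewrite !mxE.
rewrite /coef.
have -> : pr (enum_val a) *m (X *m Y) *m inj (enum_val b) =
    \sum_(r in A) (pr (enum_val a) *m X *m inj r) *m (pr r *m Y *m inj (enum_val b)).
  rewrite -[in LHS](mulmx1 X) -(dec_complete dec) mulmx_sumr mulmx_suml mulmx_sumr mulmx_suml.
  by apply: eq_bigr => r _; rewrite !mulmxA.
rewrite summxE (bigID (fun r => lab r == j)) /= [X in _ + X]big1 ?addr0 => [|r /andP[rA rj]].
  rewrite -(big_enum_val (A := mem (summands j)) (fun r => coef X (enum_val a) r * coef Y r (enum_val b))) /=.
  apply: eq_big => [r|r /andP[rA /eqP rj]]; first by rewrite inE.
  rewrite !coef_eq ?aj ?bj // -scalemxAl -scalemxAr scalerA -map_mxM /= rj Emx_idem.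
  by rewrite mxE Emx_base mulr1.
by rewrite coef_neq ?mul0mx ?mxE // aj eq_sym.
Qed.

Lemma block_inj X : intertwines X -> (forall j, block j X = 0) -> X = 0.
Proof.
move=> cX X0; rewrite -[X]mulmx1 -[X]mul1mx -(dec_complete dec).
rewrite mulmx_suml mulmx_suml big1 // => p pA; rewrite mulmx_sumr big1 // => q qA.
suff pq0 : pr p *m X *m inj q = 0.
  by rewrite -(mulmxA (inj p)) -mulmxA [_ *m (inj q *m _)]mulmxA pq0 mul0mx mulmx0.
have [pq|pq] := eqVneq (lab p) (lab q); last exact: coef_neq.
rewrite coef_eq //.
have pC : p \in summands (lab p) by apply/summandsP.
have qC : q \in summands (lab p) by apply/summandsP.
have /matrixP/(_ (enum_rank_in pC p) (enum_rank_in pC q)) := X0 (lab p).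
by rewrite !mxE !enum_rankK_in // => ->; rewrite scale0r.
Qed.

(** The matrix units are the maps from a summand to another one of the same type. *)
Lemma block_surj (M : forall j, 'M[F]_(#|summands j|)) :
  exists2 X, intertwines X & forall j, block j X = M j.
Proof.
pose X := \sum_j \sum_a \sum_b M j a b *: (inj (enum_val a) *m pr (enum_val b)).
exists X.
  split; rewrite mulmx_suml mulmx_sumr; apply: eq_bigr => j _;
  rewrite mulmx_suml mulmx_sumr; apply: eq_bigr => a _;
  rewrite mulmx_suml mulmx_sumr; apply: eq_bigr => b _;
  have /summandsP[aA aj] := enum_valP a; have /summandsP[bA bj] := enum_valP b;
  rewrite -scalemxAl -scalemxAr; congr (_ *: _); rewrite -mulmxA [RHS]mulmxA.
    by rewrite dec_prT // (dec_T dec) // aj bj -scalemxAr -scalemxAl mulmxA.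
  by rewrite dec_prD // (dec_D dec) // -scalemxAr -scalemxAl mulmxA.
move=> j; apply/matrixP => c d; rewrite !mxE /coef.
have /summandsP[cA cj] := enum_valP c; have /summandsP[dA dj] := enum_valP d.
have E (i : irrep) (a b : 'I_#|summands i|) : (pr (enum_val c) *m (M i a b *: (inj (enum_val a) *m pr (enum_val b))) *m
    inj (enum_val d)) (base j) (base j) =
    M i a b * ((enum_val c == enum_val a) && (enum_val b == enum_val d))%:R.
  have /summandsP[aA ai] := enum_valP a; have /summandsP[bA bi] := enum_valP b.
  rewrite -scalemxAr -scalemxAl (mulmxA (pr (enum_val c))) -(mulmxA (pr (enum_val c) *m _)) !(dec_orth dec) //.
  rewrite -scalemxAl -scalemxAr !scalerA -map_mxM mxE -!mulrA; congr (_ * _); rewrite mulrA -natrM mulnb.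
  case: eqP => [ca|]; rewrite ?mul0r //=.
  have -> : Emx (lab (enum_val c)) *m Emx (lab (enum_val b)) = Emx j.
    by rewrite bi -ai -ca cj Emx_idem.
  by rewrite Emx_base mulr1.
rewrite cj mulmx_sumr mulmx_suml summxE (bigD1 j) //= [X in _ + X]big1 => [|i ij]; last first.
  rewrite mulmx_sumr mulmx_suml summxE big1 // => a _.
  rewrite mulmx_sumr mulmx_suml summxE big1 // => b _.
  rewrite E; have /summandsP[aA ai] := enum_valP a.
  case: eqP => [ca|]; last by rewrite mulr0.
  by case/eqP: ij; rewrite -ai -ca cj.
rewrite addr0 mulmx_sumr mulmx_suml summxE (bigD1 c) //= [X in _ + X]big1 => [|a ac]; last first.
  rewrite mulmx_sumr mulmx_suml summxE big1 // => b _.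
  by rewrite E (inj_eq enum_val_inj) eq_sym (negPf ac) mulr0.
rewrite addr0 mulmx_sumr mulmx_suml summxE (bigD1 d) //= [X in _ + X]big1 => [|b bd]; last first.
  by rewrite E !(inj_eq enum_val_inj) (negPf bd) andbF mulr0.
by rewrite E !eqxx mulr1 addr0.
Qed.

End Blocks.

(** * Coordinates on the tensor power *)

Section Transport.
Variable R : realType.
Local Notation F := R[i].

Definition wcons k (e : 'I_2) (x : {ffun 'I_k -> 'I_2}) : {ffun 'I_k.+1 -> 'I_2} :=
  [ffun i => if unlift ord0 i is Some i' then x i' else e].

Definition wtail k (x : {ffun 'I_k.+1 -> 'I_2}) : {ffun 'I_k -> 'I_2} :=
  [ffun i => x (lift ord0 i)].

Lemma wcons0 k e (x : {ffun 'I_k -> 'I_2}) : wcons e x ord0 = e.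
Proof. by rewrite ffunE unlift_none. Qed.

Lemma wconsS k e (x : {ffun 'I_k -> 'I_2}) i : wcons e x (lift ord0 i) = x i.
Proof. by rewrite ffunE liftK. Qed.

Lemma wconsK k e (x : {ffun 'I_k -> 'I_2}) : wtail (wcons e x) = x.
Proof. by apply/ffunP => i; rewrite ffunE wconsS. Qed.

Lemma wcons_tail k (x : {ffun 'I_k.+1 -> 'I_2}) : wcons (x ord0) (wtail x) = x.
Proof. by apply/ffunP => i; rewrite ffunE; case: unliftP => [j ->|->]; rewrite ?ffunE. Qed.

Lemma sum_words k (V : nmodType) (G : {ffun 'I_k.+1 -> 'I_2} -> V) :
  \sum_x G x = \sum_e \sum_x G (wcons e x).
Proof.
rewrite pair_big /= (reindex (fun p : 'I_2 * {ffun 'I_k -> 'I_2} => wcons p.1 p.2)) //.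
exists (fun x : {ffun 'I_k.+1 -> 'I_2} => (x ord0, wtail x)) => [[e x] _|x _] /=; first by rewrite wcons0 wconsK.
exact: wcons_tail.
Qed.

(** The component of t along e_e in the first tensor factor, as a tensor of
    order k. *)
Definition slice k (e : 'I_2) (t : tpow R k.+1) : tpow R k := [ffun x => t (wcons e x)].

Lemma slice_linear k e : linear (@slice k e).
Proof. by move=> a u v; apply/ffunP => x; rewrite !ffunE. Qed.

(** The first tensor factor is acted upon by g, the others by the smaller power. *)
Lemma slice_act k g (t : tpow R k.+1) e :
  slice e (diag_act g t) = \sum_d g e d *: diag_act g (slice d t).
Proof.
apply/ffunP => x; rewrite !ffunE sum_words sum_ffunE; apply: eq_bigr => d _.
rewrite !ffunE scaler_sumr; apply: eq_bigr => y _.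
rewrite big_ord_recl !wcons0 [RHS]mulrA ffunE; congr (_ * _ * _).
by apply: eq_bigr => i _; rewrite !wconsS.
Qed.

Fixpoint vec k : tpow R k -> 'cV[F]_(tdim k) :=
  match k return tpow R k -> 'cV[F]_(tdim k) with
  | 0%N => fun t => const_mx (t [ffun=> 0])
  | k'.+1 => fun t => col_mx (vec (slice 0 t)) (vec (slice 1 t))
  end.

Fixpoint unvec k : 'cV[F]_(tdim k) -> tpow R k :=
  match k return 'cV[F]_(tdim k) -> tpow R k with
  | 0%N => fun v => [ffun=> v 0 0]
  | k'.+1 => fun v => [ffun x : {ffun 'I_k'.+1 -> 'I_2} =>
      unvec (if x ord0 == 0 then usubmx v else dsubmx v) (wtail x)]
  end.

Lemma vec_linear k : linear (@vec k).
Proof.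
elim: k => [|k IH] a u v /=; first by apply/matrixP => i j; rewrite !mxE !ffunE.
by rewrite !slice_linear !IH scale_col_mx add_col_mx.
Qed.

Lemma vecK k : cancel (@vec k) (@unvec k).
Proof.
elim: k => [|k IH] t /=.
  by apply/ffunP => x; rewrite ffunE mxE; congr (t _); apply/ffunP => -[].
apply/ffunP => x; rewrite ffunE col_mxKu col_mxKd -fun_if IH.
have -> : (if x ord0 == 0 then slice 0 t else slice 1 t) = slice (x ord0) t.
  by case: (x ord0) => [[|[|//]] ?]; congr slice; apply: val_inj.
by rewrite ffunE wcons_tail.
Qed.

Lemma unvecK k : cancel (@unvec k) (@vec k).
Proof.
elim: k => [|k IH] v /=.
  by apply/matrixP => i j; rewrite !mxE ffunE !ord1.
rewrite -[RHS]vsubmxK; congr col_mx; rewrite -[RHS]IH; congr vec;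
by apply/ffunP => x; rewrite ffunE [LHS]ffunE wcons0 wconsK.
Qed.

Lemma unvec_linear k : linear (@unvec k).
Proof. by move=> a u v; apply: (can_inj (@vecK k)); rewrite vec_linear !unvecK. Qed.

Lemma vec_act k g (t : tpow R k) : vec (diag_act g t) = kronpow g k *m vec t.
Proof.
elim: k t => [|k IH] t.
  rewrite /= mul1mx; apply/matrixP => i j; rewrite !mxE ffunE (big_pred1 [ffun=> 0]) => [|y].
    by rewrite big_ord0 mul1r.
  by apply/esym/eqP/ffunP => -[].
rewrite /= !slice_act !big_ord_recl !big_ord0 !addr0 mul_block_col.
have l0 : lift ord0 ord0 = 1 :> 'I_2 by apply: val_inj.
have vecZ a u : vec (a *: u : tpow R k) = a *: vec u.
  pose vecL : {linear tpow R k -> 'cV[F]_(tdim k)} :=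
    HB.pack (@vec k) (GRing.isLinear.Build _ _ _ _ _ (@vec_linear k)).
  by rewrite -[LHS]/(vecL _) linearZ.
by rewrite l0 !vec_linear !vecZ -!scalemxAl -!IH.
Qed.

Lemma mulmx_ext m n (X Y : 'M[F]_(m, n)) : (forall v : 'cV_n, X *m v = Y *m v) -> X = Y.
Proof.
move=> XY; apply/matrixP => a b.
by have /matrixP/(_ a 0) := XY (delta_mx b 0); rewrite -!colE !mxE.
Qed.

Definition mx_of n (h : 'cV[F]_n -> 'cV[F]_n) : 'M[F]_n := \matrix_(a, b) h (delta_mx b 0) a 0.

Lemma mx_ofE n (h : 'cV[F]_n -> 'cV[F]_n) v : linear h -> mx_of h *m v = h v.
Proof.
move=> lh; pose hL : {linear 'cV[F]_n -> 'cV[F]_n} := HB.pack h (GRing.isLinear.Build _ _ _ _ h lh).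
rewrite -[h]/(hL : _ -> _) [in RHS](matrix_sum_delta v).
apply/matrixP => a b; rewrite (ord1 b) mxE linear_sum summxE; apply: eq_bigr => c _.
by rewrite big_ord1 linearZ mxE /= mulrC mxE.
Qed.

Section Power.
Variable k : nat.

Definition endmx (f : tend R k) : 'M[F]_(tdim k) := mx_of (fun v => vec (f (unvec v))).

Lemma endmxE f v : endmx f *m v = vec (f (unvec v)).
Proof.
by apply: mx_ofE => a u w; rewrite unvec_linear linearP vec_linear.
Qed.

Lemma endmx_linear : linear endmx.
Proof.
move=> a f g; apply: mulmx_ext => v.
by rewrite mulmxDl -scalemxAl !endmxE add_lfunE scale_lfunE vec_linear.
Qed.

Lemma endmx1 : endmx 1 = 1%:M.
Proof. by apply: mulmx_ext => v; rewrite endmxE mul1mx id_lfunE unvecK. Qed.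

Lemma endmxM f g : endmx (f * g) = endmx f *m endmx g.
Proof. by apply: mulmx_ext => v; rewrite -mulmxA !endmxE comp_lfunE vecK. Qed.

Lemma endmx_inj : injective endmx.
Proof.
move=> f g fg; apply/lfunP => t; apply: (can_inj (@vecK k)).
by rewrite -(vecK t) -!endmxE fg.
Qed.

Lemma endmx_act (f : tend R k) g :
  (forall t, f (diag_act g t) = diag_act g (f t)) <-> endmx f *m kronpow g k = kronpow g k *m endmx f.
Proof.
split=> [fg|fg t].
  apply: mulmx_ext => v; rewrite -!mulmxA !endmxE -vec_act -fg; congr (vec (f _)).
  by apply: (can_inj (@vecK k)); rewrite unvecK vec_act unvecK.
apply: (can_inj (@vecK k)); rewrite vec_act -{1}(vecK (diag_act g t)) -endmxE vec_act mulmxA fg.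
by rewrite -mulmxA endmxE vecK.
Qed.

Lemma endmx_surj X : exists f, endmx f = X.
Proof.
pose h t := unvec (X *m vec t).
have lh : linear h by move=> a u v; rewrite /h vec_linear mulmxDr -scalemxAr unvec_linear.
pose hL : {linear tpow R k -> tpow R k} := HB.pack h (GRing.isLinear.Build _ _ _ _ h lh).
exists (linfun hL); apply: mulmx_ext => v.
by rewrite endmxE lfunE /= /h !unvecK.
Qed.

Lemma diag_actM g h (t : tpow R k) : diag_act (g *m h) t = diag_act g (diag_act h t).
Proof.
pose L g : {linear tpow R k -> tpow R k} :=
  HB.pack (diag_act g) (GRing.isLinear.Build _ _ _ _ _ (diag_act_linear (R := R) g)).
rewrite -[LHS]/(L (g *m h) t) -[RHS]/(L g (L h t)) (pure_span t) !linear_sum.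
apply: eq_bigr => x _; rewrite !linearZ /= !diag_act_pure.
by congr (_ *: pure _); apply/funext => i; rewrite mulmxA.
Qed.

Lemma diag_act1 (t : tpow R k) : diag_act 1%:M t = t.
Proof.
pose L : {linear tpow R k -> tpow R k} :=
  HB.pack (diag_act 1%:M) (GRing.isLinear.Build _ _ _ _ _ (diag_act_linear (R := R) 1%:M)).
rewrite -[LHS]/(L t) (pure_span t) linear_sum; apply: eq_bigr => x _.
rewrite linearZ /= diag_act_pure; congr (_ *: pure _); apply/funext => i; exact: mul1mx.
Qed.

(** Commuting with the two generators is enough; for inverses this uses that the
    elements of the group are unitary, hence invertible. *)
Lemma H1_equivariant_gen (f : tend R k) :
  f \in H1_equivariant (k := k) <->
  endmx f *m kronpow (mxT R) k = kronpow (mxT R) k *m endmx f /\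
  endmx f *m kronpow (mxD R) k = kronpow (mxD R) k *m endmx f.
Proof.
split=> [/H1_equivariantP fH|[/endmx_act fT /endmx_act fD]].
  by split; apply/endmx_act => t; apply: fH; constructor.
apply/H1_equivariantP => g t gH; elim: gH t => {g} [t|//|//|g h _ IHg _ IHh t|g gH IHg t].
- by rewrite !diag_act1.
- by rewrite !diag_actM IHg IHh.
have gU : g \in unitmx by have /unitarymxP/mulmx1_unit[] := H1_unitary gH.
by rewrite -[in RHS](diag_act1 t) -(mulmxV gU) diag_actM IHg -diag_actM mulVmx // diag_act1.
Qed.

End Power.
End Transport.

(** * Multiplicities *)

Lemma multS k :
  [/\ mult k.+1 Triv = mult k Spin, mult k.+1 Sgn = mult k SpinS,
      mult k.+1 Std = mult k Spin4,
      mult k.+1 Rot = (mult k Spin + mult k Spin4)%N &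
      mult k.+1 RotS = (mult k SpinS + mult k Spin4)%N]
  /\ [/\ mult k.+1 Spin = (mult k Triv + mult k Rot)%N,
      mult k.+1 SpinS = (mult k Sgn + mult k RotS)%N &
      mult k.+1 Spin4 = (mult k Std + mult k Rot + mult k RotS)%N].
Proof.
by split; split; rewrite /= big_mkcond /= sum_irrep /= ?addr0 ?add0r ?addr0 // addrA.
Qed.

(** The graph is bipartite. *)
Lemma mult_parity k j : spin j != odd k -> mult k j = 0%N.
Proof.
elim: k j => [|k IH] j; first by case: j.
move=> jk; apply: big1 => i /adj_spin ij; apply: IH.
by move: jk; rewrite ij /=; case: spin; case: odd.
Qed.

Lemma exp_subz (x : rat) m : x != 0 ->
  x ^ (m.+1%:Z - 1) = x ^+ m /\ x ^ (m.+1%:Z - 2) = x ^+ m / x.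
Proof.
move=> x0; have e : m.+1%:Z - 1 = m :> int by rewrite -addn1 PoszD addrK.
by rewrite -[2]/(1 + 1 : int) opprD addrA e -exprnP expfzDr // exprz_inv.
Qed.

Lemma mult_even m :
  [/\ (mult (2 * m.+1) Triv)%:R = d_plus m.+1, (mult (2 * m.+1) Sgn)%:R = d_minus m.+1,
      (mult (2 * m.+1) Std)%:R = d_zero m.+1, (mult (2 * m.+1) Rot)%:R = e_plus m.+1 &
      (mult (2 * m.+1) RotS)%:R = e_minus m.+1].
Proof.
rewrite /d_plus /d_minus /d_zero /e_plus /e_minus.
have [_ ->] := @exp_subz 2 m isT; have [-> ->] := @exp_subz 4 m isT.
elim: m => [|m [IHt IHs IHd IHr IHr']].
  have [[-> -> -> -> ->] _] := multS 1.
  by have [_ [-> -> ->]] := multS 0; split.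
rewrite mulnS addSn add1n.
have [[-> -> -> -> ->] _] := multS (2 * m.+1).+1.
have [_ [-> -> ->]] := multS (2 * m.+1).
rewrite !natrD IHt IHs IHd IHr IHr' !exprS; split; lra.
Qed.

(** Triv, Sgn and Std are ends of the graph: each has the multiplicity that its
    only neighbour has one step before. *)
Lemma mult_odd m :
  [/\ (mult (2 * m.+1 - 1) Spin)%:R = d_plus m.+1, (mult (2 * m.+1 - 1) SpinS)%:R = d_minus m.+1 &
      (mult (2 * m.+1 - 1) Spin4)%:R = d_zero m.+1].
Proof.
have := mult_even m; rewrite mulnS addSn add1n subn1 -[_.-1]/(2 * m).+1.
by have [[-> -> -> _ _] _] := multS (2 * m).+1; case.
Qed.

(** * The isomorphism *)

Lemma inj_surj_bij T U (f : T -> U) : injective f -> (forall y, exists x, f x = y) -> bijective f.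
Proof. by move=> fI /choice[g gK]; exists g => // x; apply: fI. Qed.

Section Final.
Variables (R : realType) (k : nat).
Local Notation F := R[i].
Variables (I : finType) (A : {set I}) (lab : I -> irrep).
Variables (inj : I -> 'M[F]_(tdim k, 4)) (pr : I -> 'M[F]_(4, tdim k)) (t s : F).
Hypothesis dec : decomposition A lab inj pr t s.

Definition component j (f : centralizer R k) : 'M[F]_(#|summands A lab j|) :=
  block A lab inj pr j (endmx (val f)).

Lemma centralizer_intertwines (f : centralizer R k) : intertwines (endmx (val f)).
Proof. by apply/H1_equivariant_gen; apply: valP. Qed.

Lemma component_linear j : linear (component j).
Proof. by move=> a f g; rewrite /component linearP endmx_linear block_linear. Qed.

Lemma component1 j : component j 1 = 1.
Proof. by rewrite /component rmorph1 endmx1 (block1 dec). Qed.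

Lemma componentM j f g : component j (f * g) = component j f * component j g.
Proof. by rewrite /component rmorphM endmxM (blockM dec) //; apply: centralizer_intertwines. Qed.

Lemma component_inj f g : (forall j, component j f = component j g) -> f = g.
Proof.
move=> fg; apply: val_inj; apply: endmx_inj; apply/eqP; rewrite -subr_eq0; apply/eqP.
have -> : endmx (val f) - endmx (val g) = endmx (val (f - g)).
  by rewrite -scaleN1r addrC -endmx_linear scaleN1r addrC -raddfB.
apply: (block_inj dec) => [|j]; first exact: centralizer_intertwines.
by rewrite [f - g]addrC -scaleN1r -/(component j _) component_linear fg scaleN1r addNr.
Qed.

Lemma component_surj (M : forall j, 'M[F]_(#|summands A lab j|)) :
  exists f, forall j, component j f = M j.
Proof.
have [X cX XM] := block_surj dec M; have [f fX] := endmx_surj X.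
have fH : f \in H1_equivariant (k := k) by apply/H1_equivariant_gen; rewrite fX.
by exists (Centralizer fH) => j; rewrite -XM -fX.
Qed.

End Final.

Theorem mainTheorem1 (R : realType) (k m : nat) (hk : (1 <= k)%N)
    (hm : (1 <= m)%N) :
  (k = (2 * m - 1)%N ->
    exists dp dm d0 : nat,
      [/\ dp%:R = d_plus m, dm%:R = d_minus m, d0%:R = d_zero m &
        exists f : centralizer R k -> 'M[R[i]]_dp * 'M[R[i]]_dm * 'M[R[i]]_d0,
          [/\ linear f, monoid_morphism f & bijective f]]) /\
  (k = (2 * m)%N ->
    exists dp dm d0 ep em : nat,
      [/\ [/\ dp%:R = d_plus m, dm%:R = d_minus m & d0%:R = d_zero m],
          ep%:R = e_plus m, em%:R = e_minus m &
        exists f : centralizer R k ->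
            'M[R[i]]_dp * 'M[R[i]]_dm * 'M[R[i]]_d0 * 'M[R[i]]_ep * 'M[R[i]]_em,
          [/\ linear f, monoid_morphism f & bijective f]]).
Proof.
have [I [A [lab [inj [pr [t [s [dec cnt]]]]]]]] := tpow_decomposes R k.
have absent j : spin j != odd k -> forall M N : 'M[R[i]]_(#|summands A lab j|), M = N.
  move=> jk; have := cnt j; rewrite mult_parity // -/(summands A lab j).
  by case: #|_| => // _ M N; apply/matrixP => -[].
pose c j := component A lab inj pr j.
case: m hm => [//|m _]; split=> kE.
  have odd_k : odd k by rewrite kE subn1 mulnS addSn /= mul2n odd_double.
  exists #|summands A lab Spin|, #|summands A lab SpinS|, #|summands A lab Spin4|.
  have [dpE dmE d0E] := mult_odd m.
  rewrite -kE in dpE dmE d0E; split; [by rewrite cnt | by rewrite cnt | by rewrite cnt |].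
  exists (fun f => (c Spin f, c SpinS f, c Spin4 f)); split.
  - by move=> a f g; rewrite /c !component_linear.
  - by split=> [|f g]; rewrite /c ?(component1 dec) ?(componentM dec).
  apply: inj_surj_bij => [f g [e1 e2 e3]|[[M1 M2] M3]].
    apply: (component_inj dec) => j.
    case: j; [..|exact: e1|exact: e2|exact: e3]; by apply: absent; rewrite odd_k.
  have [f fM] := component_surj dec (fun j => match j with Spin => M1 | SpinS => M2 | Spin4 => M3 | _ => 0 end).
  by exists f; rewrite /c (fM Spin) (fM SpinS) (fM Spin4).
have even_k : odd k = false by rewrite kE mul2n odd_double.
exists #|summands A lab Triv|, #|summands A lab Sgn|, #|summands A lab Std|, #|summands A lab Rot|, #|summands A lab RotS|.
have [dpE dmE d0E epE emE] := mult_even m.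
rewrite -kE in dpE dmE d0E epE emE.
split; [by split; rewrite cnt | by rewrite cnt | by rewrite cnt |].
exists (fun f => (c Triv f, c Sgn f, c Std f, c Rot f, c RotS f)); split.
- by move=> a f g; rewrite /c !component_linear.
- by split=> [|f g]; rewrite /c ?(component1 dec) ?(componentM dec).
apply: inj_surj_bij => [f g [e1 e2 e3 e4 e5]|[[[[M1 M2] M3] M4] M5]].
  apply: (component_inj dec) => j.
  case: j; [exact: e1|exact: e2|exact: e3|exact: e4|exact: e5|..]; by apply: absent; rewrite even_k.
have [f fM] := component_surj dec (fun j => match j with
  Triv => M1 | Sgn => M2 | Std => M3 | Rot => M4 | RotS => M5 | _ => 0 end).
by exists f; rewrite /c (fM Triv) (fM Sgn) (fM Std) (fM Rot) (fM RotS).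
Qed.
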